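(* If $\mathbf{x}\in\mathbb{R}^{N_{\mathbf{x}}\times 1}$ and $\mathbf{y}\in\mathbb{C}^{N_{\mathbf{y}}\times 1}$ are connected via the linear model $\mathbf{y}=\mathbf{H}\mathbf{x}+\mathbf{n}$, then the weighted widely linear least squares (WWLLS) estimator for real valued parameter vectors $\hat{\mathbf{x}}_{\mathrm{WLS}}$ is given by $$\hat{\mathbf{x}}_{\mathrm{WLS}}=\mathbf{G}_{\mathrm{WLS}}\,\underline{\mathbf{y}},$$ where the estimator matrix $\mathbf{G}_{\mathrm{WLS}}$ is defined as $$\mathbf{G}_{\mathrm{WLS}}=\left(\widetilde{\mathbf{H}}^H\underline{\mathbf{W}}\widetilde{\mathbf{H}}\right)^{-1}\widetilde{\mathbf{H}}^H\underline{\mathbf{W}}.$$ Here, $\underline{\mathbf{W}}$ is defined as $$\underline{\mathbf{W}}=\begin{bmatrix}\mathbf{W}&\mathbf{0}\\ \mathbf{0}&\mathbf{W}^*\end{bmatrix}$$ with $\mathbf{W}$ being a Hermitian weighting matrix. This result can further be simplified to $$\hat{\mathbf{x}}_{\mathrm{WLS}}=\left(\Re\{\mathbf{H}^H\mathbf{W}\mathbf{H}\}\right)^{-1}\left(\Re\{\mathbf{H}^H\mathbf{W}\mathbf{y}\}\right).$$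
   Context: Notation: $(\cdot)^T$, $(\cdot)^H$ and $(\cdot)^*$ denote transposition, conjugate transposition and (entrywise) complex conjugation; $\Re\{\cdot\}$ denotes the (entrywise) real part. Linear model: $\mathbf{y}=\mathbf{H}\mathbf{x}+\mathbf{n}$, where $\mathbf{x}\in\mathbb{R}^{N_{\mathbf{x}}\times 1}$ is a real valued parameter vector, $\mathbf{y}\in\mathbb{C}^{N_{\mathbf{y}}\times 1}$ is a complex valued measurement vector, $\mathbf{H}\in\mathbb{C}^{N_{\mathbf{y}}\times N_{\mathbf{x}}}$ is a complex valued measurement matrix, and $\mathbf{n}\in\mathbb{C}^{N_{\mathbf{y}}\times 1}$ is a complex valued zero mean random noise vector. Augmented quantities: $$\underline{\mathbf{y}}=\begin{bmatrix}\mathbf{y}\\ \mathbf{y}^*\end{bmatrix}\in\mathbb{C}^{2N_{\mathbf{y}}\times 1},\qquad \widetilde{\mathbf{H}}=\begin{bmatrix}\mathbf{H}\\ \mathbf{H}^*\end{bmatrix}\in\mathbb{C}^{2N_{\mathbf{y}}\times N_{\mathbf{x}}}.$$ WWLLS estimator for real valued parameter vectors: the estimator derived by minimizing, over real valued $\mathbf{x}$, the weighted least squares cost function $$J(\mathbf{x})=(\mathbf{y}-\mathbf{H}\mathbf{x})^H\mathbf{W}(\mathbf{y}-\mathbf{H}\mathbf{x}),$$ where $\mathbf{W}\in\mathbb{C}^{N_{\mathbf{y}}\times N_{\mathbf{y}}}$ is a Hermitian weighting matrix.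
   Formalization: As W is only Hermitian, J may have no minimizer (e.g. H=1, W=-1). What is shown: any minimizer equals the formula, and the formula is a minimizer whenever J is bounded below (e.g. W positive semidefinite); the inverted matrix in G_WLS is assumed invertible. *)

(* Defs.v *)
(* MathComp with MathComp-Analysis; complex scalars are R[i] over R : realType. *)
From HB Require Import structures.
From mathcomp Require Import all_boot all_order all_algebra.
From mathcomp Require Import all_classical all_reals all_analysis.
From mathcomp Require Import complex.

Set Implicit Arguments.
Unset Strict Implicit.
Unset Printing Implicit Defensive.

Import Order.TTheory GRing.Theory Num.Theory.
Import numFieldNormedType.Exports.

Local Open Scope ring_scope.
Local Open Scope complex_scope.
Local Open Scope sesquilinear_scope.

Definition toCmx (R : realType) (m n : nat) (A : 'M[R]_(m, n)) : 'M[R[i]]_(m, n) :=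
  map_mx (real_complex R) A.

Definition Remx (R : realType) (m n : nat) (A : 'M[R[i]]_(m, n)) : 'M[R]_(m, n) :=
  map_mx (@complex.Re R) A.

Definition conjmx (R : realType) (m n : nat) (A : 'M[R[i]]_(m, n)) : 'M[R[i]]_(m, n) :=
  map_mx Num.conj A.

Definition augment (R : realType) (m n : nat) (A : 'M[R[i]]_(m, n)) :
    'M[R[i]]_(m + m, n) :=
  col_mx A (conjmx A).

Definition augment_weight (R : realType) (n : nat) (W : 'M[R[i]]_n) :
    'M[R[i]]_(n + n) :=
  block_mx W 0 0 (conjmx W).

(* The expectation of a complex random variable is the complex number formed
   by the expectations of its real and imaginary parts. *)
Definition zero_mean (R : realType) (d : measure_display) (Omega : measurableType d)
    (P : probability Omega R) (n : nat) (N : Omega -> 'cV[R[i]]_n) : Prop :=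
  forall i : 'I_n,
    [/\ P.-integrable setT (EFin \o (fun w => complex.Re (N w i 0))),
        P.-integrable setT (EFin \o (fun w => complex.Im (N w i 0))),
        expectation P (fun w => complex.Re (N w i 0)) = 0%E
      & expectation P (fun w => complex.Im (N w i 0)) = 0%E].

(* The cost is the single entry of a 1 x 1 matrix.  It is left complex valued:
   it is real when W is Hermitian, and on real elements of R[i] the order is
   the usual one. *)
Definition wls_cost (R : realType) (Ny Nx : nat) (H : 'M[R[i]]_(Ny, Nx))
    (W : 'M[R[i]]_Ny) (y : 'cV[R[i]]_Ny) (x : 'cV[R]_Nx) : R[i] :=
  ((y - H *m toCmx x)^t* *m W *m (y - H *m toCmx x)) 0 0.

Definition is_WWLLS_estimate (R : realType) (Ny Nx : nat)
    (H : 'M[R[i]]_(Ny, Nx)) (W : 'M[R[i]]_Ny) (y : 'cV[R[i]]_Ny)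
    (xhat : 'cV[R]_Nx) : Prop :=
  forall x : 'cV[R]_Nx, wls_cost H W y xhat <= wls_cost H W y x.

Definition wls_cost_bounded_below (R : realType) (Ny Nx : nat)
    (H : 'M[R[i]]_(Ny, Nx)) (W : 'M[R[i]]_Ny) (y : 'cV[R[i]]_Ny) : Prop :=
  exists c : R[i], forall x : 'cV[R]_Nx, c <= wls_cost H W y x.

(* invmx is the matrix inverse only on unitmx; statements using G_WLS assume
   that the matrix inverted here is in unitmx. *)
Definition G_WLS (R : realType) (Ny Nx : nat) (H : 'M[R[i]]_(Ny, Nx))
    (W : 'M[R[i]]_Ny) : 'M[R[i]]_(Nx, Ny + Ny) :=
  invmx ((augment H)^t* *m augment_weight W *m augment H)
    *m (augment H)^t* *m augment_weight W.

(* Main.v *)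
Require Import Defs.
From HB Require Import structures.
From mathcomp Require Import all_boot all_order all_algebra.
From mathcomp Require Import all_classical all_reals all_analysis.
From mathcomp Require Import complex.
From mathcomp Require Import ring lra.

Set Implicit Arguments.
Unset Strict Implicit.
Unset Printing Implicit Defensive.

Import Order.TTheory GRing.Theory Num.Theory.
Import numFieldNormedType.Exports.

Local Open Scope ring_scope.
Local Open Scope complex_scope.
Local Open Scope sesquilinear_scope.

(** Write M = Re (H^H W H) and g = Re (H^H W y).

    The lower half of every augmented object is the entrywise conjugate of its
    upper half, so an augmented product H~^H W_ B_ is a matrix plus its own
    conjugate, that is, twice the real part of H^H W B ([augment_form]).  The
    normal matrix of [G_WLS] is therefore 2 M and its right-hand side 2 g; the
    factors 2 cancel and [G_WLS] applied to the augmented measurement is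
    M^-1 g ([G_WLS_augment]).

    The estimator itself comes from an exact expansion of the cost
    ([wls_cost_shift]): for real x and h,

      J(x + h) = J(x) + h^T M h - 2 h^T (g - M x).

    As W is Hermitian the increment is real, so the order on complex numbers
    compares costs as the order on the reals does.  If x minimises J, then the
    increment along t h is nonnegative for every real t, which kills its linear
    term; with h = g - M x this is the normal equation M x = g
    ([WWLLS_normal_equation]).  Conversely, W may be indefinite, so a solution
    of M x = g is only a stationary point in general; a lower bound on J forces
    h^T M h >= 0 for all h, because h can be scaled, and then the stationary
    point is a minimiser ([WWLLS_of_normal_equation]). *)

(** * Real and complex matrices *)

Lemma conjC_real_complex (R : realType) (a : R) : Num.conj a%:C = a%:C.
Proof. exact: conjc_real. Qed.

Lemma addC_conj (R : realType) (z : R[i]) :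
  z + Num.conj z = 2 * (complex.Re z)%:C.
Proof. exact: addcJ. Qed.

Lemma toCmx_inj (R : realType) m n : injective (@toCmx R m n).
Proof.
by move=> A B /matrixP eqAB; apply/matrixP => i j;
  apply: complexI; have := eqAB i j; rewrite !mxE.
Qed.

Lemma toCmxM (R : realType) m n p (A : 'M[R]_(m, n)) (B : 'M[R]_(n, p)) :
  toCmx (A *m B) = toCmx A *m toCmx B.
Proof. exact: map_mxM. Qed.

Lemma conjmxM (R : realType) m n p (A : 'M[R[i]]_(m, n)) (B : 'M[R[i]]_(n, p)) :
  Defs.conjmx (A *m B) = Defs.conjmx A *m Defs.conjmx B.
Proof. exact: map_mxM. Qed.

Lemma conjmx_toC (R : realType) m n (B : 'M[R]_(m, n)) :
  Defs.conjmx (toCmx B) = toCmx B.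
Proof. by apply/matrixP => i j; rewrite !mxE conjC_real_complex. Qed.

Lemma adjointM (C : numClosedFieldType) m n p (A : 'M[C]_(m, n))
    (B : 'M[C]_(n, p)) : (A *m B)^t* = B^t* *m A^t*.
Proof. by rewrite trmx_mul map_mxM. Qed.

Lemma adjointB (C : numClosedFieldType) m n (A B : 'M[C]_(m, n)) :
  (A - B)^t* = A^t* - B^t*.
Proof. by rewrite linearB map_mxB. Qed.

Lemma adjoint_toC (R : realType) m n (B : 'M[R]_(m, n)) :
  (toCmx B)^t* = toCmx B^T.
Proof. by apply/matrixP => i j; rewrite !mxE conjC_real_complex. Qed.

(** Characterising the real part through conjugation turns its compatibility
    with real factors into plain bilinearity of the matrix product. *)
Lemma toCmx_Remx (R : realType) m n (A : 'M[R[i]]_(m, n)) :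
  toCmx (Remx A) = 2^-1 *: (A + Defs.conjmx A).
Proof. by apply/matrixP => i j; rewrite !mxE ReJ_add mulrC. Qed.

Lemma addmx_conj (R : realType) m n (A : 'M[R[i]]_(m, n)) :
  A + Defs.conjmx A = 2 *: toCmx (Remx A).
Proof. by rewrite toCmx_Remx scalerA divff ?scale1r // pnatr_eq0. Qed.

Lemma Remx_toC_mul (R : realType) m n p (B : 'M[R]_(m, n))
    (A : 'M[R[i]]_(n, p)) : Remx (toCmx B *m A) = B *m Remx A.
Proof.
apply: toCmx_inj.
by rewrite toCmxM !toCmx_Remx conjmxM conjmx_toC -scalemxAr mulmxDr.
Qed.

Lemma Remx_mul_toC (R : realType) m n p (A : 'M[R[i]]_(m, n))
    (B : 'M[R]_(n, p)) : Remx (A *m toCmx B) = Remx A *m B.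
Proof.
apply: toCmx_inj.
by rewrite toCmxM !toCmx_Remx conjmxM conjmx_toC -scalemxAl mulmxDl.
Qed.

Lemma RemxE (R : realType) m n (A : 'M[R[i]]_(m, n)) i j :
  Remx A i j = complex.Re (A i j).
Proof. by rewrite mxE. Qed.

Lemma RemxB (R : realType) m n (A B : 'M[R[i]]_(m, n)) :
  Remx (A - B) = Remx A - Remx B.
Proof. by apply/matrixP => i j; rewrite !mxE; case: (A i j) (B i j) => ? ? []. Qed.

(** * The augmented normal equations *)

(** The weight is block diagonal, so the product is the sum of an upper part
    and of its conjugate. *)
Lemma augment_form (R : realType) Ny m n (H : 'M[R[i]]_(Ny, m))
    (W : 'M[R[i]]_Ny) (B : 'M[R[i]]_(Ny, n)) :
  (augment H)^t* *m augment_weight W *m augment B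
    = 2 *: toCmx (Remx (H^t* *m W *m B)).
Proof.
rewrite -addmx_conj !conjmxM /augment /augment_weight tr_col_mx map_row_mx.
rewrite mul_row_block !mulmx0 addr0 add0r mul_row_col.
by rewrite {2}/Defs.conjmx map_trmx.
Qed.

Lemma normal_matrix_unit (R : realType) Ny Nx (H : 'M[R[i]]_(Ny, Nx))
    (W : 'M[R[i]]_Ny) :
  ((augment H)^t* *m augment_weight W *m augment H \in unitmx)
    = (Remx (H^t* *m W *m H) \in unitmx).
Proof.
by rewrite augment_form unitmxZ ?unitfE ?pnatr_eq0 // map_unitmx.
Qed.

Lemma G_WLS_augment (R : realType) Ny Nx (H : 'M[R[i]]_(Ny, Nx))
    (W : 'M[R[i]]_Ny) (y : 'cV[R[i]]_Ny) :
  Remx (H^t* *m W *m H) \in unitmx ->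
  G_WLS H W *m augment y
    = toCmx (invmx (Remx (H^t* *m W *m H)) *m Remx (H^t* *m W *m y)).
Proof.
move=> M_unit; rewrite /G_WLS -2!(mulmxA (invmx _)) !augment_form.
rewrite invmxZ; last by rewrite unitmxZ ?unitfE ?pnatr_eq0 // map_unitmx.
rewrite -scalemxAl -scalemxAr scalerA mulVf ?pnatr_eq0 // scale1r.
by rewrite toCmxM -map_invmx.
Qed.

(** * The cost as a real quadratic *)

Lemma hermsymmx_adjoint (C : numClosedFieldType) n (W : 'M[C]_n) :
  W \is hermsymmx -> W^t* = W.
Proof.
by move=> /is_hermitianmxP W_herm; move: (W_herm); rewrite expr0 scale1r => <-.
Qed.

Lemma hermitian_form_real (R : realType) n (W : 'M[R[i]]_n) (k : 'cV[R[i]]_n) :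
  W^t* = W ->
  (k^t* *m W *m k) 0 0 = (complex.Re ((k^t* *m W *m k) 0 0))%:C.
Proof.
move=> W_herm.
have selfadj : (k^t* *m W *m k)^t* = k^t* *m W *m k.
  by rewrite !adjointM W_herm trmxCK mulmxA.
have conj_fix : Num.conj ((k^t* *m W *m k) 0 0) = (k^t* *m W *m k) 0 0.
  by rewrite -[in RHS]selfadj [in RHS]mxE [in RHS]mxE.
move: (_ 0 0) conj_fix => z conj_fix.
by apply/esym/RRe_real/CrealP.
Qed.

(** The two cross terms are conjugate to each other, and the quadratic term is
    real; hence expanding the form changes it by a real number. *)
Lemma hermitian_formB (R : realType) n (W : 'M[R[i]]_n) (r k : 'cV[R[i]]_n) :
  W^t* = W ->
  ((r - k)^t* *m W *m (r - k)) 0 0 = (r^t* *m W *m r) 0 0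
    + (complex.Re ((k^t* *m W *m k) 0 0)
       - 2 * complex.Re ((k^t* *m W *m r) 0 0))%:C.
Proof.
move=> W_herm.
have cross : r^t* *m W *m k = (k^t* *m W *m r)^t*.
  by rewrite !adjointM W_herm trmxCK mulmxA.
rewrite rmorphB rmorphM rmorph_nat /= -hermitian_form_real // -addC_conj.
rewrite adjointB !mulmxBl !mulmxBr cross.
move: (r^t* *m W *m r) (k^t* *m W *m r) (k^t* *m W *m k) => a b c.
rewrite !mxE; ring.
Qed.

Lemma wls_cost_shift (R : realType) Ny Nx (H : 'M[R[i]]_(Ny, Nx))
    (W : 'M[R[i]]_Ny) (y : 'cV[R[i]]_Ny) (x h : 'cV[R]_Nx) :
  W \is hermsymmx ->
  wls_cost H W y (x + h) = wls_cost H W y x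
    + ((h^T *m Remx (H^t* *m W *m H) *m h) 0 0
       - 2 * (h^T *m (Remx (H^t* *m W *m y)
                      - Remx (H^t* *m W *m H) *m x)) 0 0)%:C.
Proof.
move=> /hermsymmx_adjoint W_herm; rewrite /wls_cost.
have shiftE : y - H *m toCmx (x + h) = (y - H *m toCmx x) - H *m toCmx h.
  by rewrite /toCmx map_mxD mulmxDr opprD addrA.
have adjE : (H *m toCmx h)^t* = toCmx h^T *m H^t*.
  by rewrite adjointM adjoint_toC.
have quadE : Remx (toCmx h^T *m H^t* *m W *m (H *m toCmx h))
    = h^T *m Remx (H^t* *m W *m H) *m h.
  by rewrite -Remx_toC_mul -Remx_mul_toC !mulmxA.
have linE : Remx (toCmx h^T *m H^t* *m W *m (y - H *m toCmx x))
    = h^T *m (Remx (H^t* *m W *m y) - Remx (H^t* *m W *m H) *m x).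
  by rewrite -Remx_mul_toC -RemxB -Remx_toC_mul mulmxBr !mulmxA mulmxBr !mulmxA.
rewrite -quadE -linE !RemxE -adjE shiftE.
exact: hermitian_formB.
Qed.

(** * Minimising a real quadratic *)

(** Near t = 0 the linear term dominates. *)
Lemma quadratic_ge0_lin0 (R : realFieldType) (q s : R) :
  (forall t, 0 <= t ^+ 2 * q - 2 * (t * s)) -> s = 0.
Proof.
move=> quad_ge0; have c_gt0 : 0 < `|q| + 1 by rewrite ltr_wpDl.
(* At t = s / c the value is t^2 (q - 2 c); c = |q| + 1 makes q - 2 c
   negative. *)
have := quad_ge0 (s / (`|q| + 1)); set c := `|q| + 1 in c_gt0 *.
have -> : (s / c) ^+ 2 * q - 2 * (s / c * s) = (s / c) ^+ 2 * (q - 2 * c).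
  by field; rewrite gt_eqF.
have coef_lt0 : q - 2 * c < 0.
  by have := ler_norm q; have := normr_ge0 q; rewrite /c; lra.
rewrite nmulr_lge0 // => sq_le0.
have /eqP : (s / c) ^+ 2 = 0 by apply/eqP; rewrite eq_le sq_le0 sqr_ge0.
by rewrite sqrf_eq0 mulf_eq0 invr_eq0 (gt_eqF c_gt0) orbF => /eqP.
Qed.

Lemma quadratic_bounded_ge0 (R : realFieldType) (q b : R) :
  (forall t, b <= t ^+ 2 * q) -> 0 <= q.
Proof.
move=> bounded; rewrite leNgt; apply/negP => q_lt0.
have ratio_ge0 : 0 <= `|b| / - q by rewrite divr_ge0 // oppr_ge0 ltW.
(* If q < 0, the value at t = 1 + |b| / (- q) is at most q - 2 |b| < b. *)
have := bounded (1 + `|b| / - q).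
have -> : (1 + `|b| / - q) ^+ 2 * q
    = q - 2 * `|b| + (`|b| / - q) ^+ 2 * q.
  by field; rewrite lt_eqF.
have : (`|b| / - q) ^+ 2 * q <= 0 by rewrite mulr_ge0_le0 ?sqr_ge0 // ltW.
by have := ler_norm (- b); rewrite normrN; have := normr_ge0 b; lra.
Qed.

Lemma trmx_mul_self_eq0 (R : realDomainType) n (v : 'cV[R]_n) :
  (v^T *m v) 0 0 = 0 -> v = 0.
Proof.
rewrite mxE => /eqP; rewrite psumr_eq0 => [|i _]; last first.
  by rewrite mxE -expr2 sqr_ge0.
move=> /allP sq0; apply/matrixP => i j; rewrite ord1 [RHS]mxE.
have := sq0 i (mem_index_enum i).
by rewrite /= !mxE -expr2 sqrf_eq0 => /eqP.
Qed.

Lemma scaled_quadratic_form (R : comNzRingType) n (M : 'M[R]_n) (t : R)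
    (v : 'cV[R]_n) :
  ((t *: v)^T *m M *m (t *: v)) 0 0 = t ^+ 2 * (v^T *m M *m v) 0 0.
Proof.
have -> : (t *: v)^T = t *: v^T by rewrite linearZ.
by rewrite -!scalemxAl -scalemxAr scalerA -expr2 mxE.
Qed.

Lemma scaled_linear_form (R : pzRingType) n (t : R) (v g : 'cV[R]_n) :
  ((t *: v)^T *m g) 0 0 = t * (v^T *m g) 0 0.
Proof.
have -> : (t *: v)^T = t *: v^T by apply/matrixP => i j; rewrite !mxE.
by rewrite -scalemxAl mxE.
Qed.

(** First-order optimality, tested in the direction of the residual
    v = g - M x: the linear coefficient is then v^T v. *)
Lemma WWLLS_normal_equation (R : realType) Ny Nx (H : 'M[R[i]]_(Ny, Nx))
    (W : 'M[R[i]]_Ny) (y : 'cV[R[i]]_Ny) (x : 'cV[R]_Nx) :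
  W \is hermsymmx -> is_WWLLS_estimate H W y x ->
  Remx (H^t* *m W *m H) *m x = Remx (H^t* *m W *m y).
Proof.
move=> W_herm x_min; apply/esym/subr0_eq; set v := (X in X = 0).
apply: trmx_mul_self_eq0.
apply: (@quadratic_ge0_lin0 _ ((v^T *m Remx (H^t* *m W *m H) *m v) 0 0)) => t.
have := x_min (x + t *: v); rewrite wls_cost_shift // lerDl ler0c -/v.
by rewrite scaled_quadratic_form scaled_linear_form.
Qed.

(** At a solution of the normal equation the cost differs from its value
    there by h^T M h alone, and along t h this is t^2 h^T M h, which a lower
    bound forces to be nonnegative. *)
Lemma WWLLS_of_normal_equation (R : realType) Ny Nx (H : 'M[R[i]]_(Ny, Nx))
    (W : 'M[R[i]]_Ny) (y : 'cV[R[i]]_Ny) (x : 'cV[R]_Nx) :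
  W \is hermsymmx -> wls_cost_bounded_below H W y ->
  Remx (H^t* *m W *m H) *m x = Remx (H^t* *m W *m y) ->
  is_WWLLS_estimate H W y x.
Proof.
move=> W_herm [c c_le] normal_eq.
have costE h : wls_cost H W y (x + h) = wls_cost H W y x
    + ((h^T *m Remx (H^t* *m W *m H) *m h) 0 0)%:C.
  rewrite wls_cost_shift // -normal_eq subrr mulmx0.
  by rewrite [X in 2 * X]mxE mulr0 subr0.
move=> x'; rewrite -(subrKC x x') costE lerDl ler0c; set h := x' - x.
apply: (@quadratic_bounded_ge0 _ _ (complex.Re (c - wls_cost H W y x))) => t.
have := c_le (x + t *: h); rewrite costE -lerBlDl lecE => /andP[_].
by rewrite scaled_quadratic_form.
Qed.

Theorem mainTheorem3 (R : realType) (Ny Nx : nat)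
    (d : measure_display) (Omega : measurableType d) (P : probability Omega R)
    (H : 'M[R[i]]_(Ny, Nx)) (W : 'M[R[i]]_Ny)
    (x : 'cV[R]_Nx) (n y : Omega -> 'cV[R[i]]_Ny)
    (n_zero_mean : zero_mean P n)
    (linear_model : forall w : Omega, y w = H *m toCmx x + n w)
    (W_hermitian : W \is hermsymmx)
    (G_WLS_defined :
      (augment H)^t* *m augment_weight W *m augment H \in unitmx) :
  Remx (H^t* *m W *m H) \in unitmx /\
  forall w : Omega,
    [/\ (* every WWLLS estimate is given by the estimator matrix *)
        forall xhat : 'cV[R]_Nx, is_WWLLS_estimate H W (y w) xhat ->
          toCmx xhat = G_WLS H W *m augment (y w),
        (* the simplified form of the formula *)
        G_WLS H W *m augment (y w) =
          toCmx (invmx (Remx (H^t* *m W *m H)) *m Remx (H^t* *m W *m y w))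
      & (* the formula is a WWLLS estimate as soon as the cost is bounded below *)
        wls_cost_bounded_below H W (y w) ->
          is_WWLLS_estimate H W (y w)
            (invmx (Remx (H^t* *m W *m H)) *m Remx (H^t* *m W *m y w))].
Proof.
have M_unit : Remx (H^t* *m W *m H) \in unitmx by rewrite -normal_matrix_unit.
split=> // w; split=> [xhat xhat_min||bounded].
- by rewrite G_WLS_augment // -(WWLLS_normal_equation W_hermitian xhat_min) mulKmx.
- exact: G_WLS_augment.
- by apply: WWLLS_of_normal_equation => //; rewrite mulKVmx.
Qed.
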